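(* Let $\mathcal{G}=(\mathcal{N},\mathcal{E})$ be a connected undirected graph with $n\ge 2$ nodes, and let $\mathbf{W}$ be a positive semidefinite mixing matrix on $\mathcal{G}$ with $\lambda_{\mathbf{W}}<1$. For any $\delta\in(0,1]$, define $\mathbf{W}^{(\delta)}:=(1-\delta)\mathbf{I}+\delta\mathbf{W}$. Then $\mathbf{W}^{(\delta)}$ is a positive semidefinite mixing matrix on $\mathcal{G}$. Moreover, $$1-\lambda_{\mathbf{W}^{(\delta)}}=\delta\,(1-\lambda_{\mathbf{W}}),\qquad \tau_{\mathbf{W}^{(\delta)}}=\frac{\tau_{\mathbf{W}}}{\delta}.$$
   Context: Graphs have node set $\mathcal{N}=\{1,\dots,n\}$ and no self-loops. A real $n\times n$ matrix $\mathbf{W}$ is a mixing matrix on a connected undirected graph $\mathcal{G}$ if it is entrywise nonnegative, symmetric, doubly stochastic, and for all $i\ne j$: $[\mathbf{W}]_{ij}>0$ if and only if $\{i,j\}$ is an edge of $\mathcal{G}$ (diagonal entries are unrestricted apart from nonnegativity). With $\mathbf{J}=\mathbf{1}\mathbf{1}^\top/n$ and $\|\cdot\|_2$ the spectral norm, $\lambda_{\mathbf{W}}:=\|\mathbf{W}-\mathbf{J}\|_2$, and $\tau_{\mathbf{W}}:=1/(1-\lambda_{\mathbf{W}})$ when $\lambda_{\mathbf{W}}<1$. *)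

(* Defs.v *)
From HB Require Import structures.
From mathcomp Require Import all_boot all_order all_algebra.
From mathcomp Require Import boolp classical_sets reals.

Set Implicit Arguments.
Unset Strict Implicit.
Unset Printing Implicit Defensive.

Import Order.TTheory GRing.Theory Num.Theory.

Local Open Scope classical_set_scope.
Local Open Scope ring_scope.

Definition connected_graph (n : nat) (e : rel 'I_n) : Prop :=
  [/\ symmetric e, irreflexive e & forall i j : 'I_n, connect e i j].

Definition doubly_stochastic (R : realType) (n : nat) (W : 'M[R]_n) : Prop :=
  [/\ forall i j, 0 <= W i j,
      forall i, \sum_j W i j = 1
    & forall j, \sum_i W i j = 1].

(* The diagonal of W is constrained only by nonnegativity and the row sums. *)
Definition mixing_matrix (R : realType) (n : nat) (e : rel 'I_n)
    (W : 'M[R]_n) : Prop :=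
  [/\ forall i j, 0 <= W i j,
      W^T = W,
      doubly_stochastic W
    & forall i j, i != j -> (0 < W i j) <-> e i j].

Definition psd (R : realType) (n : nat) (A : 'M[R]_n) : Prop :=
  A^T = A /\ forall x : 'cV[R]_n, 0 <= (x^T *m A *m x) 0 0.

Definition l2norm (R : realType) (n : nat) (x : 'cV[R]_n) : R :=
  Num.sqrt (\sum_i x i 0 ^+ 2).

(* Operator norm induced by the Euclidean norm. The library norm on matrices
   is the entrywise maximum, hence not usable here. *)
Definition spectral_norm (R : realType) (n : nat) (A : 'M[R]_n) : R :=
  sup [set l2norm (A *m x) | x in [set x : 'cV[R]_n | l2norm x <= 1]].

Definition avg_mx (R : realType) (n : nat) : 'M[R]_n :=
  n%:R^-1 *: ((const_mx 1 : 'cV[R]_n) *m (const_mx 1 : 'cV[R]_n)^T).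

Definition lambda_mx (R : realType) (n : nat) (W : 'M[R]_n) : R :=
  spectral_norm (W - avg_mx R n).

(* Meaningful when lambda_mx W < 1. *)
Definition tau_mx (R : realType) (n : nat) (W : 'M[R]_n) : R :=
  1 / (1 - lambda_mx W).

Definition lazy_mx (R : realType) (n : nat) (delta : R) (W : 'M[R]_n) :
    'M[R]_n :=
  (1 - delta) *: 1%:M + delta *: W.

(* Main.v *)
Require Import Defs.
From mathcomp Require Import all_boot all_order all_algebra.
From mathcomp Require Import classical_sets reals.
From mathcomp Require Import ring lra.

Import Order.TTheory GRing.Theory Num.Theory.
Local Open Scope ring_scope.

(** Write [J] for the averaging matrix, [P = I - J] and [B = W - J].  Since [W]
    is symmetric and fixes the constant vectors, [W J = J W = J]; hence
    [B = P W P] is positive semidefinite, [B P = B], and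
    [W^(delta) - J = (1 - delta) P + delta B].  So the whole content is the
    equality [|a P + d B| = a + d |B|] for a nonzero orthogonal projection [P],
    a positive semidefinite [B] with [B P = B], and [a, d >= 0]
    ([spectral_norm_projD]).

    Spectrally this says that a top eigenvector of [B] may be taken in the range
    of [P], where [a P + d B] acts as [a I + d B].  No eigenvector is needed,
    though: Cauchy-Schwarz for the form [<u, B v>] gives
    [|B y|^2 <= |B| <y, B y>] ([psd_sqnorm_le]), and this lower bound on the
    cross term of [|a y + d B y|^2] yields
    [(a + d |B|) |B y| <= |B| |a y + d B y|] for [y] in the range of [P].  Taking
    the supremum over unit vectors and dividing by [|B|] proves the claim when
    [B] is nonzero.  When [|B| = 0], a nonzero vector fixed by [P] is enough;
    for [P = I - J] one exists because [n >= 2]. *)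

(** * The Euclidean inner product *)

Section Euclidean.
Context {R : realType} {n : nat}.
Implicit Types (u v x y : 'cV[R]_n) (A B P : 'M[R]_n).

Definition dot u v : R := (u^T *m v) 0 0.

Lemma dotE u v : dot u v = \sum_i u i 0 * v i 0.
Proof. by rewrite /dot mxE; apply: eq_bigr => i _; rewrite mxE. Qed.

Lemma dotC u v : dot u v = dot v u.
Proof. by rewrite !dotE; apply: eq_bigr => i _; rewrite mulrC. Qed.

Lemma dotDr u v w : dot u (v + w) = dot u v + dot u w.
Proof. by rewrite /dot mulmxDr mxE. Qed.

Lemma dotZr a u v : dot u (a *: v) = a * dot u v.
Proof. by rewrite /dot -scalemxAr mxE. Qed.

Lemma dotDl u v w : dot (u + v) w = dot u w + dot v w.
Proof. by rewrite dotC dotDr !(dotC w). Qed.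

Lemma dotZl a u v : dot (a *: u) v = a * dot u v.
Proof. by rewrite dotC dotZr dotC. Qed.

Lemma dot_mull A u v : dot (A *m u) v = dot u (A^T *m v).
Proof. by rewrite /dot trmx_mul mulmxA. Qed.

Lemma dotxx_ge0 u : 0 <= dot u u.
Proof. by rewrite dotE sumr_ge0 // => i _; rewrite -expr2 sqr_ge0. Qed.

Lemma psd_dot A : psd A -> forall x, 0 <= dot x (A *m x).
Proof. by case=> _ hA x; rewrite /dot mulmxA. Qed.

Lemma psd1 : psd (1%:M : 'M[R]_n).
Proof.
split; first exact: trmx1.
by move=> x; rewrite mulmx1; exact: dotxx_ge0.
Qed.

(** Positivity at [c u - b v], where [b = <u, B v>] and [c = <v, B v>], settles
    [c > 0], and by symmetry [<u, B u> > 0]; if both vanish, positivity at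
    [u + v] and [u - v] forces [b = 0]. *)
Lemma psd_CauchySchwarz B u v : psd B ->
  dot u (B *m v) ^+ 2 <= dot u (B *m u) * dot v (B *m v).
Proof.
move=> hB; have hq := psd_dot B hB.
set b := dot u (B *m v); set a := dot u _; set c := dot v _.
have sym : dot v (B *m u) = b by case: hB => hT _; rewrite -{1}hT -dot_mull dotC.
have form s t : 0 <= s ^+ 2 * a + 2 * (s * t) * b + t ^+ 2 * c.
  have := hq (s *: u + t *: v).
  rewrite mulmxDr -!scalemxAr !dotDr !dotDl !dotZr !dotZl sym -/a -/b -/c.
  lra.
have [a0 c0] : 0 <= a /\ 0 <= c by split; apply: hq.
have [cp|] := ltP 0 c.
  rewrite -subr_ge0 -(pmulr_rge0 _ cp).
  by have := form c (- b); lra.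
have [ap|] := ltP 0 a.
  move=> _; rewrite -subr_ge0 -(pmulr_rge0 _ ap).
  by have := form (- b) a; lra.
move=> a0' c0'; have := form 1 1; have := form 1 (-1).
have -> : a = 0 by lra.
have -> : c = 0 by lra.
move=> h1 h2; have -> : b = 0 by lra.
by rewrite expr2 !mul0r.
Qed.

Lemma l2norm_ge0 x : 0 <= l2norm x.
Proof. exact: sqrtr_ge0. Qed.

Lemma sqr_l2norm x : l2norm x ^+ 2 = dot x x.
Proof.
rewrite /l2norm sqr_sqrtr ?dotE; first by apply: eq_bigr => i _; rewrite expr2.
by apply: sumr_ge0 => i _; exact: sqr_ge0.
Qed.

Lemma l2norm0 : l2norm (0 : 'cV[R]_n) = 0.
Proof. by apply/eqP; rewrite -sqrf_eq0 sqr_l2norm /dot mulmx0 mxE. Qed.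

Lemma l2norm_eq0 x : l2norm x = 0 -> x = 0.
Proof.
move=> x0; have /eqP : dot x x = 0 by rewrite -sqr_l2norm x0 expr0n.
rewrite dotE psumr_eq0 => [/allP h|i _]; last by rewrite -expr2 sqr_ge0.
apply/matrixP => i j; rewrite ord1 mxE.
by have := h i (mem_index_enum i); rewrite mulf_eq0 orbb => /eqP.
Qed.

Lemma l2normZ a x : 0 <= a -> l2norm (a *: x) = a * l2norm x.
Proof.
move=> a0; apply/eqP; rewrite -(@eqrXn2 _ 2) ?mulr_ge0 ?l2norm_ge0 //.
by rewrite exprMn !sqr_l2norm dotZl dotZr mulrA -expr2.
Qed.

Lemma dot_le_l2norm u v : dot u v <= l2norm u * l2norm v.
Proof.
apply: le_trans (ler_norm _) _.
rewrite -ler_sqr ?nnegrE ?mulr_ge0 ?l2norm_ge0 // real_normK ?num_real //.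
by have := psd_CauchySchwarz 1%:M u v psd1; rewrite !mul1mx exprMn !sqr_l2norm.
Qed.

Lemma l2normD u v : l2norm (u + v) <= l2norm u + l2norm v.
Proof.
rewrite -ler_sqr ?nnegrE ?addr_ge0 ?l2norm_ge0 // sqrrD !sqr_l2norm.
rewrite dotDr !dotDl (dotC v u); have := dot_le_l2norm u v; lra.
Qed.

(** * The spectral norm as an operator norm *)

(** The Frobenius norm, which is finite and hence keeps the supremum defining
    the spectral norm from taking its default value. *)
Lemma l2norm_mulmx_le_Frobenius A x :
  l2norm (A *m x) <= Num.sqrt (\sum_i \sum_j A i j ^+ 2) * l2norm x.
Proof.
have F0 : 0 <= \sum_i \sum_j A i j ^+ 2.
  by apply: sumr_ge0 => i _; apply: sumr_ge0 => j _; exact: sqr_ge0.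
rewrite -ler_sqr ?nnegrE ?mulr_ge0 ?sqrtr_ge0 ?l2norm_ge0 //.
rewrite exprMn (sqr_sqrtr F0) !sqr_l2norm dotE mulr_suml; apply: ler_sum => i _.
have -> : (A *m x) i 0 = dot (row i A)^T x by rewrite /dot trmxK -row_mul [RHS]mxE.
have := psd_CauchySchwarz 1%:M (row i A)^T x psd1; rewrite !mul1mx.
rewrite -expr2 => /le_trans; apply; apply: ler_wpM2r; first exact: dotxx_ge0.
by rewrite dotE; apply: ler_sum => j _; rewrite !mxE expr2.
Qed.

Lemma l2norm_mulmx_le_sup A x : l2norm x <= 1 ->
  l2norm (A *m x) <= spectral_norm A.
Proof.
move=> x1; apply: ub_le_sup; last by exists x.
exists (Num.sqrt (\sum_i \sum_j A i j ^+ 2)) => _ [y /= y1 <-].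
apply: le_trans (l2norm_mulmx_le_Frobenius A y) _.
by apply: ler_piMr => //; exact: sqrtr_ge0.
Qed.

Lemma spectral_norm_le A c :
  (forall x, l2norm x <= 1 -> l2norm (A *m x) <= c) -> spectral_norm A <= c.
Proof.
move=> h; apply: ge_sup; last by move=> _ [x /= x1 <-]; exact: h.
by exists (l2norm (A *m 0)); exists 0 => //=; rewrite l2norm0 ler01.
Qed.

Lemma spectral_norm_ge0 A : 0 <= spectral_norm A.
Proof.
apply: le_trans (l2norm_mulmx_le_sup A 0 _); first exact: l2norm_ge0.
by rewrite l2norm0 ler01.
Qed.

Lemma l2norm_mulmx_le A x : l2norm (A *m x) <= spectral_norm A * l2norm x.
Proof.
have [->|xn0] := eqVneq x 0; first by rewrite mulmx0 l2norm0 mulr0.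
have xp : 0 < l2norm x.
  rewrite lt_def l2norm_ge0 andbT; apply: contra_neq xn0; exact: l2norm_eq0.
rewrite -ler_pdivrMr // mulrC -l2normZ ?invr_ge0 ?l2norm_ge0 // scalemxAr.
apply: l2norm_mulmx_le_sup.
by rewrite l2normZ ?invr_ge0 ?l2norm_ge0 // mulVf // gt_eqF.
Qed.

(** The operator inequality [B^2 <= |B| B]: apply Cauchy-Schwarz for the form
    of [B] to the pair [B y], [y]. *)
Lemma psd_sqnorm_le B y : psd B ->
  l2norm (B *m y) ^+ 2 <= spectral_norm B * dot y (B *m y).
Proof.
move=> hB; set z := B *m y; set m := l2norm z; set L := spectral_norm B.
have q0 : 0 <= dot y z by exact: psd_dot.
have m0 : 0 <= m by exact: l2norm_ge0.
have L0 : 0 <= L by exact: spectral_norm_ge0.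
have cs : m ^+ 2 * m ^+ 2 <= dot z (B *m z) * dot y z.
  by have := psd_CauchySchwarz B z y hB; rewrite -/z -sqr_l2norm -/m expr2.
have hz : dot z (B *m z) <= L * m ^+ 2.
  apply: le_trans (dot_le_l2norm _ _) _; rewrite -/m expr2 mulrCA.
  by apply: ler_wpM2l => //; exact: l2norm_mulmx_le.
have [mp|m0'] := ltP 0 m; last first.
  have -> : m = 0 by lra.
  by rewrite expr0n mulr_ge0.
have m2 : 0 < m ^+ 2 by exact: exprn_gt0.
rewrite -(ler_pM2l m2); apply: le_trans cs _.
by rewrite mulrCA mulrA ler_wpM2r.
Qed.

(** * Adding a projection to a positive semidefinite matrix *)

Lemma l2norm_proj_le P x : P^T = P -> P *m P = P -> l2norm (P *m x) <= l2norm x.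
Proof.
move=> PT PP; set y := P *m x; have [yp|y0] := ltP 0 (l2norm y); last first.
  exact: le_trans y0 (l2norm_ge0 _).
rewrite -(ler_pM2r yp) -expr2 sqr_l2norm {1}/y dot_mull PT /y mulmxA PP.
exact: dot_le_l2norm.
Qed.

(** On the range of [P], an eigenvalue [mu] of [B] becomes [a + d mu] in
    [a P + d B], and both matrices vanish on the kernel of [P]. *)
Lemma spectral_norm_projD P B a d :
    P^T = P -> P *m P = P -> P != 0 -> psd B -> B *m P = B ->
    0 <= a -> 0 <= d ->
  spectral_norm (a *: P + d *: B) = a + d * spectral_norm B.
Proof.
move=> PT PP Pn0 hB BP a0 d0.
set L := spectral_norm B; set C := a *: P + d *: B; set N := spectral_norm C.
have L0 : 0 <= L by exact: spectral_norm_ge0.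
have CE x : C *m x = a *: (P *m x) + d *: (B *m x).
  by rewrite /C mulmxDl -!scalemxAl.
apply/eqP; rewrite eq_le; apply/andP; split.
  apply: spectral_norm_le => x x1; rewrite CE.
  apply: le_trans (l2normD _ _) _; rewrite !l2normZ //; apply: lerD.
    apply: ler_piMr => //; apply: le_trans x1; exact: l2norm_proj_le.
  by apply: ler_wpM2l => //; exact: l2norm_mulmx_le_sup.
have [Lp|L0'] := ltP 0 L; last first.
  (* Here B = 0, so C = a P scales any nonzero column of P by a. *)
  have Lz : L = 0 by lra.
  have [j pj] : exists j, col j P != 0.
    apply/existsP; move: Pn0; apply: contraR; rewrite negb_exists => /forallP h.
    apply/eqP/matrixP => i j; have := h j; rewrite negbK => /eqP/matrixP/(_ i 0).
    by rewrite !mxE.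
  set y := col j P in pj.
  have Py : P *m y = y by rewrite /y !colE mulmxA PP.
  have By : B *m y = 0.
    apply: l2norm_eq0; apply/eqP; rewrite eq_le l2norm_ge0 andbT.
    by apply: le_trans (l2norm_mulmx_le B y) _; rewrite -/L Lz mul0r.
  have yp : 0 < l2norm y.
    rewrite lt_def l2norm_ge0 andbT; apply: contra_neq pj; exact: l2norm_eq0.
  rewrite Lz mulr0 addr0 -(ler_pM2r yp) -l2normZ //.
  by have := l2norm_mulmx_le C y; rewrite CE Py By scaler0 addr0.
have s0 : 0 <= a + d * L by rewrite addr_ge0 ?mulr_ge0.
have N0 : 0 <= N by exact: spectral_norm_ge0.
have key x : l2norm x <= 1 -> (a + d * L) * l2norm (B *m x) <= L * N.
  move=> x1; set y := P *m x.
  have Py : P *m y = y by rewrite /y mulmxA PP.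
  have By : B *m x = B *m y by rewrite /y mulmxA BP.
  have yN : l2norm (C *m y) <= N.
    by apply: l2norm_mulmx_le_sup; apply: le_trans x1; exact: l2norm_proj_le.
  apply: (@le_trans _ _ (L * l2norm (C *m y))); last exact: ler_wpM2l.
  rewrite By; set m := l2norm (B *m y).
  have m0 : 0 <= m by exact: l2norm_ge0.
  rewrite -ler_sqr ?nnegrE ?mulr_ge0 ?l2norm_ge0 // !exprMn (sqr_l2norm (C *m y)).
  rewrite CE Py !dotDr !dotDl !dotZr !dotZl (dotC (B *m y) y) -!sqr_l2norm -/m.
  set q := dot y (B *m y).
  have h1 : m ^+ 2 <= L * q by exact: psd_sqnorm_le.
  have h2 : m ^+ 2 <= L ^+ 2 * l2norm y ^+ 2.
    by rewrite -exprMn ler_sqr ?nnegrE ?mulr_ge0 ?l2norm_ge0 ?l2norm_mulmx_le.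
  (* The two bounds on m ^+ 2 enter the expansion of |a y + d B y|^2 through
     its cross term and through its |y|^2 term. *)
  have k1 : 0 <= 2 * a * d * L * (L * q - m ^+ 2).
    by rewrite !mulr_ge0 // subr_ge0.
  have k2 : 0 <= a ^+ 2 * (L ^+ 2 * l2norm y ^+ 2 - m ^+ 2).
    by rewrite mulr_ge0 ?sqr_ge0 // subr_ge0.
  rewrite -subr_ge0; have := addr_ge0 k1 k2; lra.
have [sp|] := ltP 0 (a + d * L); last by move/le_trans; apply.
rewrite -(ler_pM2l Lp) mulrC -ler_pdivlMl //.
apply: spectral_norm_le => x x1; rewrite ler_pdivlMl //; exact: key.
Qed.

End Euclidean.

(** * Averaging and mixing matrices *)

Section Averaging.
Context {R : realType} {n : nat}.
Implicit Types (W : 'M[R]_n).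
Local Notation J := (avg_mx R n).

Lemma avg_mxE i j : J i j = n%:R^-1.
Proof. by rewrite !mxE big_ord1 !mxE !mulr1. Qed.

Lemma trmx_avg : J^T = J.
Proof. by apply/matrixP => i j; rewrite mxE !avg_mxE. Qed.

Lemma mul_avg_mx W : (forall j, \sum_i W i j = 1) -> J *m W = J.
Proof.
move=> h; apply/matrixP => i j; rewrite mxE avg_mxE.
by under eq_bigr do rewrite avg_mxE; rewrite -mulr_sumr h mulr1.
Qed.

Lemma mul_mx_avg W : (forall i, \sum_j W i j = 1) -> W *m J = J.
Proof.
move=> h; apply/matrixP => i j; rewrite mxE avg_mxE.
by under eq_bigr do rewrite avg_mxE; rewrite -mulr_suml h mul1r.
Qed.

Lemma mul_avg_avg : J *m J = J.
Proof.
apply: mul_avg_mx => j; under eq_bigr do rewrite avg_mxE.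
rewrite sumr_const card_ord -[_ *+ n]mulr_natr mulVf // pnatr_eq0.
by rewrite -lt0n; apply: leq_trans (ltn_ord j).
Qed.

Lemma trmx_centering : (1%:M - J)^T = 1%:M - J.
Proof. by rewrite linearB /= trmx1 trmx_avg. Qed.

Lemma mul_centering : (1%:M - J) *m (1%:M - J) = 1%:M - J.
Proof.
by rewrite mulmxBr mulmx1 mulmxBl mul1mx mul_avg_avg subrr subr0.
Qed.

Lemma centering_neq0 : (2 <= n)%N -> 1%:M - J != 0.
Proof.
move=> n2; have n0 : (0 < n)%N by exact: ltnW.
apply/eqP => /matrixP /(_ (Ordinal n0) (Ordinal n2)).
rewrite mxE [X in _ + X]mxE avg_mxE !mxE /= add0r => /eqP.
by rewrite oppr_eq0 invr_eq0 pnatr_eq0 -leqn0 leqNgt n0.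
Qed.

(** [W - J] is the compression [P W P] of [W] by the centering projection
    [P = I - J]. *)
Lemma psd_sub_avg W : psd W -> doubly_stochastic W -> psd (W - J).
Proof.
move=> [WT Wpos] [_ hr hc]; split; first by rewrite linearB /= WT trmx_avg.
have -> : W - J = (1%:M - J) *m W *m (1%:M - J).
  rewrite mulmxBl mul1mx mul_avg_mx // mulmxBr mulmx1 mulmxBl mul_mx_avg //.
  by rewrite mul_avg_avg subrr subr0.
move=> x; have := Wpos ((1%:M - J) *m x).
by rewrite trmx_mul trmx_centering !mulmxA.
Qed.

Lemma sub_avg_centering W :
  (forall i, \sum_j W i j = 1) -> (W - J) *m (1%:M - J) = W - J.
Proof.
move=> h; rewrite mulmxBr mulmx1 mulmxBl mul_mx_avg // mul_avg_avg.
by rewrite subrr subr0.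
Qed.

Lemma lazy_mxE (delta : R) W i j :
  lazy_mx delta W i j = (1 - delta) * (i == j)%:R + delta * W i j.
Proof. by rewrite !mxE. Qed.

Lemma lazy_mx_sub_avg (delta : R) W :
  lazy_mx delta W - J = (1 - delta) *: (1%:M - J) + delta *: (W - J).
Proof.
by apply/matrixP => i j; rewrite /lazy_mx !mxE; ring.
Qed.

Lemma trmx_lazy (delta : R) W : W^T = W -> (lazy_mx delta W)^T = lazy_mx delta W.
Proof. by move=> WT; rewrite /lazy_mx linearD /= !linearZ /= trmx1 WT. Qed.

Lemma doubly_stochastic_lazy (delta : R) W : 0 <= delta -> delta <= 1 ->
  doubly_stochastic W -> doubly_stochastic (lazy_mx delta W).
Proof.
move=> d0 d1 [W0 hr hc]; split=> [i j|i|j].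
- by rewrite lazy_mxE addr_ge0 ?mulr_ge0 ?subr_ge0 ?ler0n.
- under eq_bigr do rewrite lazy_mxE.
  rewrite big_split /= -!mulr_sumr hr (bigD1 i) //= eqxx /= big1 => [|j ji].
    by ring.
  by rewrite eq_sym (negPf ji).
- under eq_bigr do rewrite lazy_mxE.
  rewrite big_split /= -!mulr_sumr hc (bigD1 j) //= eqxx /= big1 => [|i ij].
    by ring.
  by rewrite (negPf ij).
Qed.

Lemma mixing_matrix_lazy (e : rel 'I_n) (delta : R) W :
  0 < delta -> delta <= 1 -> mixing_matrix e W ->
  mixing_matrix e (lazy_mx delta W).
Proof.
move=> d0 d1 [_ WT dsW We].
have dsL := doubly_stochastic_lazy delta W (ltW d0) d1 dsW.
split=> //; first by case: dsL.
  exact: trmx_lazy.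
move=> i j ij; rewrite lazy_mxE (negPf ij) mulr0 add0r pmulr_rgt0 //.
exact: We.
Qed.

Lemma psd_lazy (delta : R) W : 0 <= delta -> delta <= 1 ->
  psd W -> psd (lazy_mx delta W).
Proof.
move=> d0 d1 hW; split; first by apply: trmx_lazy; case: hW.
move=> x; rewrite -mulmxA -/(dot _ _) /lazy_mx mulmxDl -!scalemxAl mul1mx.
rewrite dotDr !dotZr addr_ge0 ?mulr_ge0 ?subr_ge0 ?dotxx_ge0 //.
exact: psd_dot.
Qed.

Lemma lambda_lazy (delta : R) W : (2 <= n)%N -> 0 <= delta -> delta <= 1 ->
  psd W -> doubly_stochastic W ->
  lambda_mx (lazy_mx delta W) = (1 - delta) + delta * lambda_mx W.
Proof.
move=> n2 d0 d1 hW dsW; rewrite /lambda_mx lazy_mx_sub_avg.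
apply: spectral_norm_projD; rewrite ?subr_ge0 //.
- exact: trmx_centering.
- exact: mul_centering.
- exact: centering_neq0.
- exact: psd_sub_avg.
- by apply: sub_avg_centering; case: dsW.
Qed.

End Averaging.

Theorem theorem2p1 (R : realType) (n : nat) (hn : (2 <= n)%N)
    (e : rel 'I_n) (he : connected_graph e)
    (W : 'M[R]_n) (hW : mixing_matrix e W) (hpsd : psd W)
    (hlam : lambda_mx W < 1)
    (delta : R) (hdelta0 : 0 < delta) (hdelta1 : delta <= 1) :
  [/\ mixing_matrix e (lazy_mx delta W),
      psd (lazy_mx delta W),
      1 - lambda_mx (lazy_mx delta W) = delta * (1 - lambda_mx W)
    & tau_mx (lazy_mx delta W) = tau_mx W / delta].
Proof.
have gap : 1 - lambda_mx (lazy_mx delta W) = delta * (1 - lambda_mx W).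
  case: hW => _ _ dsW _; rewrite lambda_lazy ?(ltW hdelta0) //; ring.
split=> //.
- exact: mixing_matrix_lazy.
- by apply: psd_lazy => //; exact: ltW.
- by rewrite /tau_mx gap !div1r invfM mulrC.
Qed.
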